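(* Let $f\in\mathbb{R}[x]$ be a polynomial with an irrational coefficient (other than the constant term) and let $F:\mathbb{N}\to\mathbb{C}$ be a bounded multiplicative function. Then $$\lim_{N\to\infty}\frac1N\sum_{n=1}^NF(n)e^{2\pi if(n)}=0.$$
   Context: $\mathbb{N}=\{1,2,\dots\}$. A function $F:\mathbb{N}\to\mathbb{C}$ is multiplicative if $F(ab)=F(a)F(b)$ for any coprime $a,b\in\mathbb{N}$. *)

(* Defs.v *)
From HB Require Import structures.
From mathcomp Require Import all_boot all_order all_algebra.
From mathcomp Require Import complex.
From mathcomp Require Import all_classical all_reals all_analysis.

Set Implicit Arguments.
Unset Strict Implicit.
Unset Printing Implicit Defensive.

Import Order.TTheory GRing.Theory Num.Theory.
Import numFieldNormedType.Exports.

Local Open Scope ring_scope.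
Local Open Scope complex_scope.

(* R[i] packaged as a numClosedFieldType, so that it gets the norm and topology
   that numFieldNormedType provides for such structures; on the bare record type
   R[i] these are not inferred. *)
Definition Cplx (R : realType) : numClosedFieldType := R[i].

(* e^{it} for real t, by Euler's formula: the complex exponential is not in the
   library. *)
Definition expi (R : realType) (t : R) : Cplx R := cos t +i* sin t.

(* Functions on {1, 2, ...} are total functions on nat whose value at 0 is
   irrelevant, hence the positivity conditions below. *)
Definition multiplicative_fun (R : realType) (F : nat -> Cplx R) : Prop :=
  forall a b : nat, (0 < a)%N -> (0 < b)%N -> coprime a b ->
    F (a * b)%N = F a * F b.

Definition bounded_posnat (R : realType) (F : nat -> Cplx R) : Prop :=
  [bounded F n | n in [set n : nat | (0 < n)%N]%classic].

(* Main.v *)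
Require Import Defs.
From HB Require Import structures.
From mathcomp Require Import all_boot all_order all_algebra.
From mathcomp Require Import complex.
From mathcomp Require Import all_classical all_reals all_analysis.
From mathcomp Require Import ring lra.

Import Order.TTheory GRing.Theory Num.Theory.
Import numFieldNormedType.Exports.

Local Open Scope classical_set_scope.
Local Open Scope ring_scope.
Local Open Scope complex_scope.

(** Write e(t) for exp(2 pi i t) and g(n) = e(f(n)). A bounded multiplicative F
    cannot correlate with g as soon as the dilated sequences g(p n) and g(q n)
    are asymptotically orthogonal for distinct primes p and q: this is the
    criterion of Daboussi and Katai, [katai_criterion]. It holds because, for a
    finite set of primes whose reciprocals have the sum M, a typical n <= N has
    close to M divisors p in that set; the sum of F(n) g(n) is thus 1/M times
    the sum of F(p m) g(p m), essentially F(m) F(p) g(p m), over p and m. For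
    fixed m the inner sum over p has square-root cancellation on average, and M
    may be taken large because the sum of 1/p over the primes diverges
    ([sum_prime_reciprocals_unbounded]).

    The correlation of g(p n) with g(q n) is the Weyl sum of the polynomial
    f(p x) - f(q x), which again has an irrational coefficient
    ([phase_poly_dilation]). By Weyl's theorem ([weyl_sum_sublinear]) such sums
    are o(N). Its proof is an induction on the degree of the last irrational
    coefficient: differencing ([van_der_corput]) lowers this degree to 1, and
    then n -> e(f(n)) is, up to a period, a geometric progression
    ([weyl_linear]).

    One inequality, [almost_orthogonal], is used three times: for the shifts of
    a sequence in van der Corput's lemma, for the indicators of divisibility by
    primes, and for the dilates g(p m). *)

(** * The real-valued modulus *)
Section Modulus.
Context {R : realType}.
Implicit Types (z w : Cplx R) (t : R).

(** The norm of a complex number is again a complex number; its real part is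
    the same number in an ordered field, where estimates can be combined. *)
Definition modulus z : R := complex.Re `|z|.

Lemma normE z : `|z| = (modulus z)%:C.
Proof. by rewrite /modulus RRe_real // normr_real. Qed.

Lemma modulus_ge0 z : 0 <= modulus z.
Proof. by rewrite -ler0c -normE. Qed.

Lemma modulusM z w : modulus (z * w) = modulus z * modulus w.
Proof. by apply: complexI; rewrite -normE normrM !normE -rmorphM. Qed.

Lemma modulusD z w : modulus (z + w) <= modulus z + modulus w.
Proof. by rewrite -lecR rmorphD /= -!normE ler_normD. Qed.

Lemma modulus0 : modulus 0 = 0.
Proof. by rewrite /modulus normr0. Qed.

Lemma modulusN z : modulus (- z) = modulus z.
Proof. by rewrite /modulus normrN. Qed.

Lemma modulus_sum {I : Type} (s : seq I) (P : pred I) (g : I -> Cplx R) :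
  modulus (\sum_(i <- s | P i) g i) <= \sum_(i <- s | P i) modulus (g i).
Proof.
apply: (big_ind2 (fun (x : Cplx R) (y : R) => modulus x <= y));
  rewrite ?modulus0 //.
by move=> x1 x2 y1 y2 h1 h2; apply: le_trans (modulusD _ _) _; exact: lerD.
Qed.

Lemma modulus_sqr z : modulus z ^+ 2 = complex.Re (z * z^*%C).
Proof.
apply: complexI; rewrite rmorphXn /= -normE sqr_normc RRe_real //.
by rewrite ger0_real // mulcJ_ge0.
Qed.

Lemma Re_le_modulus z : complex.Re z <= modulus z.
Proof.
apply: le_trans (ler_norm _) _.
by rewrite -lecR -normE; exact: normc_ge_Re.
Qed.

Lemma modulus_real t : modulus (t%:C : Cplx R) = `|t|.
Proof. by rewrite /modulus normc_def /= expr0n addr0 sqrtr_sqr. Qed.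
End Modulus.

(** * Sequences that are eventually below every multiple of N *)
Section Sublinear.
Context {R : realType}.
Implicit Types (x y : nat -> R).

(** For a nonnegative sequence this is x = o(N); the one-sided form spares the
    absolute values. *)
Definition sublinear x :=
  forall e : R, 0 < e -> \forall N \near \oo, x N <= e * N%:R.

Lemma sublinear_le {x} y : (forall N, x N <= y N) -> sublinear y -> sublinear x.
Proof.
move=> xy hy e e0; near=> N; apply: le_trans (xy N) _; near: N; exact: hy.
Unshelve. all: by end_near. Qed.

Lemma eq_sublinear {x} y : x =1 y -> sublinear y -> sublinear x.
Proof. by move=> xy; apply: sublinear_le => N; rewrite xy. Qed.

Lemma sublinearD {x y} :
  sublinear x -> sublinear y -> sublinear (fun N => x N + y N).
Proof.
move=> hx hy e e0; have e20 : 0 < e / 2 by rewrite divr_gt0.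
near=> N.
have : x N <= e / 2 * N%:R by near: N; exact: hx.
have : y N <= e / 2 * N%:R by near: N; exact: hy.
lra.
Unshelve. all: by end_near. Qed.

Lemma sublinear_bounded (K : R) : sublinear (fun=> K).
Proof.
move=> e e0; near=> N.
rewrite -ler_pdivrMl //; near: N; exact: nbhs_infty_ger.
Unshelve. all: by end_near. Qed.

Lemma sublinear_sum (I : Type) (s : seq I) (P : pred I) (x : I -> nat -> R) :
  (forall i, P i -> sublinear (x i)) ->
  sublinear (fun N => \sum_(i <- s | P i) x i N).
Proof.
move=> h; elim: s => [|i s IH].
  apply: (eq_sublinear (fun=> 0)); last exact: sublinear_bounded.
  by move=> N; rewrite big_nil.
apply: (eq_sublinear (fun N => (if P i then x i N else 0) +
                               \sum_(i <- s | P i) x i N)).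
  by move=> N; rewrite big_cons; case: ifP => //; rewrite add0r.
apply: sublinearD IH; case: (boolP (P i)) => [/h //|_].
exact: sublinear_bounded.
Qed.

Lemma sublinearZ (c : R) x :
  0 <= c -> sublinear x -> sublinear (fun N => c * x N).
Proof.
move=> c0 hx e e0.
have c1 : 0 < c + 1 by lra.
have ec : 0 < e / (c + 1) by rewrite divr_gt0.
near=> N.
have h : x N <= e / (c + 1) * N%:R by near: N; exact: hx.
apply: le_trans (ler_wpM2l c0 h) _.
rewrite mulrA; apply: ler_wpM2r => //.
rewrite mulrCA; apply: ler_piMr; first exact: ltW.
by rewrite ler_pdivrMr //; lra.
Unshelve. all: by end_near. Qed.

Lemma sublinear_div x (r : nat) : (0 < r)%N ->
  sublinear x -> sublinear (fun N => x (N %/ r)%N).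
Proof.
move=> r0 hx e e0; case: (hx e e0) => N0 _ H.
exists (N0 * r)%N => // N /= hN.
have h : (N0 <= N %/ r)%N by rewrite leq_divRL.
apply: le_trans (H _ h) _.
by rewrite ler_pM2l // ler_nat leq_div.
Qed.

End Sublinear.

(** * Bilinear sums over almost orthogonal families *)
Section AlmostOrthogonality.
Context {R : realType}.

Lemma sqr_sum_le (N : nat) (x : nat -> R) :
  (\sum_(1 <= n < N.+1) x n) ^+ 2 <= N%:R * \sum_(1 <= n < N.+1) x n ^+ 2.
Proof.
case: N => [|N]; first by rewrite !big_geq // expr0n mul0r.
set S := \sum_(1 <= n < N.+2) x n; set Q := \sum_(1 <= n < _) _.
have N0 : 0 < N.+1%:R :> R by [].
pose t := S / N.+1%:R.
have : 0 <= \sum_(1 <= n < N.+2) (x n - t) ^+ 2.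
  by apply: sumr_ge0 => i _; exact: sqr_ge0.
have : \sum_(1 <= n < N.+2) (x n - t) ^+ 2 =
       Q - 2 * t * S + N.+1%:R * t ^+ 2.
  under eq_bigr do rewrite sqrrB.
  rewrite big_split sumrB /= big_const_nat subn1 iter_addr_0 /=.
  rewrite -/Q; congr (_ - _ + _); last by rewrite mulr_natl.
  by rewrite /S mulr_sumr; apply: eq_bigr => i _; ring.
move=> ->.
have -> : Q - 2 * t * S + N.+1%:R * t ^+ 2 = Q - S ^+ 2 / N.+1%:R.
  by rewrite /t; move: N.+1%:R N0 => m m0; field; rewrite gt_eqF.
by rewrite subr_ge0 ler_pdivrMr // mulrC.
Qed.

(** By Cauchy-Schwarz in n, the square of the left-hand side is at most
    A^2 N times the sum over n of |sum_i w_i(n)|^2. Expanding this second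
    moment gives the diagonal terms, at most N sum_i d_i, and the correlations
    of distinct i and j, which together are eventually at most N: this is
    where the summand 1 under the root comes from. The gain is that a sum of
    k terms costs only the square root of k. The vectors w_i may depend on N,
    so that they can be truncated at N. *)
Lemma almost_orthogonal (s : seq nat) (w : nat -> nat -> nat -> Cplx R)
    (d : nat -> R) (a : nat -> Cplx R) (A : R) :
  uniq s ->
  (forall n, (0 < n)%N -> modulus (a n) <= A) ->
  (forall i N, i \in s ->
     \sum_(1 <= n < N.+1) modulus (w i N n) ^+ 2 <= d i * N%:R) ->
  (forall i j, i \in s -> j \in s -> i != j ->
     sublinear (fun N =>
       modulus (\sum_(1 <= n < N.+1) w i N n * (w j N n)^*%C))) ->
  \forall N \near \oo,
    modulus (\sum_(1 <= n < N.+1) a n * \sum_(i <- s) w i N n) <=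
    A * N%:R * Num.sqrt (\sum_(i <- s) d i + 1).
Proof.
move=> us hA hd ho.
have A0 : 0 <= A by exact: le_trans (modulus_ge0 (a 1%N)) (hA _ _).
pose off N := \sum_(i <- s | i \in s) \sum_(j <- s | (j \in s) && (i != j))
   modulus (\sum_(1 <= n < N.+1) w i N n * (w j N n)^*%C).
have off1 : sublinear off.
  apply: sublinear_sum => i si; apply: sublinear_sum => j /andP[sj ij].
  exact: ho.
have := off1 1 ltr01; apply: filterS => N; rewrite mul1r => hoff.
pose v n := \sum_(i <- s) w i N n.
have hv : \sum_(1 <= n < N.+1) modulus (v n) ^+ 2 <=
          (\sum_(i <- s) d i + 1) * N%:R.
  have -> : \sum_(1 <= n < N.+1) modulus (v n) ^+ 2 =
    \sum_(i <- s) \sum_(j <- s)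
     complex.Re (\sum_(1 <= n < N.+1) w i N n * (w j N n)^*%C).
    under [RHS]eq_bigr do under eq_bigr do rewrite raddf_sum.
    under [RHS]eq_bigr do rewrite exchange_big.
    rewrite exchange_big; apply: eq_bigr => n _ /=.
    rewrite modulus_sqr /v rmorph_sum mulr_suml raddf_sum.
    apply: eq_bigr => i _.
    by rewrite mulr_sumr raddf_sum.
  rewrite mulrDl mul1r; apply: le_trans (lerD (lexx _) hoff).
  rewrite mulr_suml big_seq [X in _ <= X + _]big_seq -big_split /=.
  apply: ler_sum => i si.
  rewrite (bigD1_seq i) //= lerD //.
    apply: le_trans (hd i N si).
    rewrite raddf_sum /=; apply: ler_sum => n _.
    by rewrite modulus_sqr.
  rewrite big_seq_cond (eq_bigl (fun j => (j \in s) && (i != j))); last first.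
    by move=> j; rewrite eq_sym.
  apply: ler_sum => j _; exact: Re_le_modulus.
have D0 : 0 <= \sum_(i <- s) d i + 1.
  apply: addr_ge0 => //; rewrite big_seq; apply: sumr_ge0 => i si.
  have := hd i 1%N si; rewrite mulr1; apply: le_trans.
  by apply: sumr_ge0 => n _; exact: sqr_ge0.
apply: le_trans (modulus_sum _ _ _) _.
apply: (@le_trans _ _ (A * \sum_(1 <= n < N.+1) modulus (v n))).
  rewrite mulr_sumr big_nat [leRHS]big_nat; apply: ler_sum => n /andP[n0 _].
  by rewrite modulusM ler_wpM2r ?modulus_ge0 // hA.
rewrite -mulrA ler_wpM2l //.
rewrite -ler_sqr ?nnegrE ?mulr_ge0 ?sqrtr_ge0 ?sumr_ge0 //; last first.
  by move=> *; exact: modulus_ge0.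
apply: le_trans (sqr_sum_le _ _) _.
rewrite exprMn sqr_sqrtr // expr2 -mulrA ler_wpM2l // mulrC //.
Qed.
End AlmostOrthogonality.

(** * Van der Corput differencing *)
Section VanDerCorput.
Context {R : realType}.

(** The estimates drawn from [almost_orthogonal] compare M times a sum with
    the square root of M + 1; this is the trade-off that lets M tend to
    infinity. *)
Lemma sqrt_growth (e : R) : 0 < e ->
  exists B : R, forall M, B <= M -> 2 * Num.sqrt (M + 1) + 4 <= e * M.
Proof.
move=> e0; exists ((1 + 4 / e) ^+ 2) => M hM.
have e40 : 0 < 4 / e by rewrite divr_gt0.
set t := Num.sqrt _.
have M0 : 0 <= M by apply: le_trans hM; exact: sqr_ge0.
have tM : t ^+ 2 = M + 1 by rewrite sqr_sqrtr //; lra.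
have t1 : 1 + 4 / e <= t.
  rewrite -ler_sqr ?nnegrE ?sqrtr_ge0 //; last by lra.
  by rewrite tM; lra.
(* With t^2 = M + 1 the claim is 2t + 4 <= e (t - 1)(t + 1), and t >= 1 makes
   the left side at most 4 (t + 1). *)
have -> : M = (t - 1) * (t + 1) by rewrite -[M](addrK 1) -tM; ring.
have h : 4 <= e * (t - 1).
  by rewrite mulrC -ler_pdivrMr //; lra.
rewrite mulrA; apply: (@le_trans _ _ (4 * (t + 1))); first by lra.
by apply: ler_wpM2r => //; lra.
Qed.

Lemma shifted_sum_le (u : nat -> Cplx R) (N h : nat) :
  (forall n, modulus (u n) <= 1) ->
  modulus (\sum_(1 <= n < N.+1) u (n + h)%N - \sum_(1 <= n < N.+1) u n) <=
  2 * h%:R.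
Proof.
move=> u1; elim: h => [|h IH].
  by under eq_bigr do rewrite addn0; rewrite subrr modulus0 mulr0.
have -> : \sum_(1 <= n < N.+1) u (n + h.+1)%N =
   \sum_(1 <= n < N.+1) u (n + h)%N + (u (N.+1 + h)%N - u h.+1).
  have := telescope_sumr (fun n => u (n + h)%N) (isT : (0 < 1 <= N.+1)%N).
  rewrite add1n => <-; rewrite -big_split /=; apply: eq_bigr => n _.
  by rewrite addSnnS addrC subrK.
rewrite addrAC -[h.+1%:R]natr1 mulrDr mulr1; apply: le_trans (modulusD _ _) _.
apply: lerD IH _; apply: le_trans (modulusD _ _) _.
by rewrite modulusN; have := u1 (N.+1 + h)%N; have := u1 h.+1; lra.
Qed.

(** The sum of u changes by a bounded amount under a shift, so H times the sum
    is, up to O(H^2), the sum of u(n + h) over n and over h < H. The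
    hypothesis says that the shifts are almost orthogonal, so this double sum
    is at most about N sqrt H; divide by H and let H grow. *)
Lemma van_der_corput (u : nat -> Cplx R) :
  (forall n, modulus (u n) <= 1) ->
  (forall h k, h != k ->
     sublinear (fun N =>
       modulus (\sum_(1 <= n < N.+1) u (n + h)%N * (u (n + k)%N)^*%C))) ->
  sublinear (fun N => modulus (\sum_(1 <= n < N.+1) u n)).
Proof.
move=> u1 hu e e0.
have [B hB] := sqrt_growth _ e0.
have [H H0 BH] : exists2 H : nat, (0 < H)%N & B <= H%:R.
  exists (Num.truncn B).+1 => //; exact/ltW/truncnS_gt.
have HR : 0 < H%:R :> R by rewrite ltr0n.
have ao : \forall N \near \oo,
    modulus (\sum_(1 <= n < N.+1) 1 * \sum_(h <- iota 0 H) u (n + h)%N)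
    <= 1 * N%:R * Num.sqrt (\sum_(h <- iota 0 H) 1 + 1).
  apply: (almost_orthogonal _ (fun h _ n => u (n + h)%N)) => //.
  - exact: iota_uniq.
  - by move=> n _; rewrite /modulus normr1.
  - move=> h N _; rewrite mul1r -[N in leRHS]subn0 -subSS -[leRHS]addr0.
    rewrite -iter_addr -big_const_nat; apply: ler_sum => n _.
    by rewrite expr_le1 // modulus_ge0.
  - by move=> h k _ _ hk; exact: hu.
near=> N.
have hN : 2 * H%:R ^+ 2 <= N%:R :> R by near: N; exact: nbhs_infty_ger.
have : modulus (\sum_(1 <= n < N.+1) 1 * \sum_(h <- iota 0 H) u (n + h)%N)
    <= 1 * N%:R * Num.sqrt (\sum_(h <- iota 0 H) 1 + 1) by near: N.
rewrite big_const_seq count_predT size_iota iter_addr_0 mul1r.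
under eq_bigr do rewrite mul1r.
rewrite exchange_big /= => h1.
set S := \sum_(1 <= n < N.+1) u n.
have h2 : modulus (\sum_(h <- iota 0 H)
    (\sum_(1 <= n < N.+1) u (n + h)%N - S)) <= 2 * H%:R ^+ 2.
  apply: le_trans (modulus_sum _ _ _) _.
  apply: (@le_trans _ _ (\sum_(h <- iota 0 H) 2 * H%:R)).
    rewrite big_seq [leRHS]big_seq; apply: ler_sum => h.
    rewrite mem_iota => /andP[_ hH].
    apply: le_trans (shifted_sum_le _ _ _ u1) _.
    by rewrite ler_pM2l // ler_nat ltnW.
  rewrite big_const_seq count_predT size_iota iter_addr_0.
  by rewrite -[leLHS]mulr_natr expr2 mulrA.
have h3 : H%:R * modulus S <= N%:R * Num.sqrt (H%:R + 1) + 2 * H%:R ^+ 2.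
  have -> : H%:R * modulus S = modulus (S *+ H).
    by rewrite -[S *+ H]mulr_natl modulusM; congr (_ * _);
       rewrite /modulus normr_nat -raddfMn.
  move: h2; rewrite sumrB big_const_seq count_predT size_iota iter_addr_0 => h2.
  move: h1 h2; set T := \sum_(h <- _) _ => h1 h2.
  have -> : S *+ H = T - (T - S *+ H) by rewrite opprB addrC subrK.
  apply: le_trans (modulusD _ _) _; rewrite modulusN; exact: lerD.
rewrite -(ler_pM2l HR); apply: le_trans h3 _.
have := hB _ BH; have s0 := sqrtr_ge0 (H%:R + 1 : R) => h4.
apply: (@le_trans _ _ (N%:R * (e * H%:R))); last by lra.
apply: (@le_trans _ _ (N%:R * (Num.sqrt (H%:R + 1) + 1))).
  by rewrite mulrDr mulr1 lerD2l.
by apply: ler_wpM2l => //; lra.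
Unshelve. all: by end_near. Qed.
End VanDerCorput.

(** * The additive character of the reals modulo 1 *)
Section Phase.
Context {R : realType}.
Implicit Types (t : R).

Definition phase t : Cplx R := expi (2 * pi * t).

Lemma phaseD s t : phase (s + t) = phase s * phase t.
Proof.
rewrite /phase /expi mulrDr cosD sinD.
apply/eqP; rewrite eq_complex /=; apply/andP; split; apply/eqP => //.
by rewrite addrC [cos _ * sin _]mulrC; congr (_ + _); rewrite mulrC.
Qed.

Lemma conj_phase t : (phase t)^*%C = phase (- t).
Proof. by rewrite /phase /expi mulrN cosN sinN. Qed.

Lemma modulus_phase t : modulus (phase t) = 1.
Proof. by rewrite /modulus normc_def /= cos2Dsin2 sqrtr1. Qed.

Lemma phase0 : phase 0 = 1.
Proof. by rewrite /phase /expi mulr0 cos0 sin0. Qed.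

Lemma phase_nat n : phase n%:R = 1.
Proof.
elim: n => [|n IH]; first exact: phase0.
rewrite -natr1 phaseD IH mul1r /phase mulr1 mulrC mulr_natr /expi.
by rewrite cos2pi sin2pi.
Qed.

Lemma phase_int t : t \is a Num.int -> phase t = 1.
Proof.
move=> /intrP[[] n ->]; first exact: phase_nat.
by rewrite NegzE mulrNz -conj_phase phase_nat conjc1.
Qed.

(** Reduce t modulo 1 to s in [0, 1). As cos (2 pi s) = 1 - 2 sin (pi s)^2, the
    value 1 forces sin (pi s) = 0, which is impossible for 0 < s < 1. *)
Lemma phase_eq1 t : phase t = 1 -> t \is a Num.int.
Proof.
move=> ht; pose s := t - (Num.floor t)%:~R.
have hs : phase s = 1.
  by rewrite phaseD ht mul1r phase_int // rpredN intr_int.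
have /andP[s0 s1] : 0 <= s < 1.
  have /andP[h1 h2] := floor_itv t; rewrite intrD in h2.
  by rewrite /s; apply/andP; split; lra.
case: (ltgtP 0 s) s0 => // [s0|s0] _; last first.
  by rewrite -[t](subrK (Num.floor t)%:~R) -/s -s0 add0r intr_int.
have pi0 := pi_gt0 R.
have : 0 < sin (pi * s) by apply: sin_gt0_pi; rewrite mulr_gt0 //= gtr_pMr.
have : cos ((pi * s) *+ 2) = 1.
  have := congr1 (@complex.Re R) hs; rewrite /phase /= => <-.
  by congr cos; ring.
rewrite cos_mulr2n cos2sin2 => h sp.
have : sin (pi * s) ^+ 2 > 0 by rewrite exprn_gt0.
lra.
Qed.
End Phase.

(** * Rational and irrational reals *)
Section Rationality.
Context {R : realType}.
Implicit Types (x y : R).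

Lemma rational_nat n : rational (n%:R : R).
Proof. by exists n%:R => //; rewrite ratr_nat. Qed.

Lemma rationalD x y : rational x -> rational y -> rational (x + y).
Proof. by move=> [p _ <-] [q _ <-]; exists (p + q) => //; rewrite rmorphD. Qed.

Lemma rationalB x y : rational x -> rational y -> rational (x - y).
Proof. by move=> [p _ <-] [q _ <-]; exists (p - q) => //; rewrite rmorphB. Qed.

Lemma rationalM x y : rational x -> rational y -> rational (x * y).
Proof. by move=> [p _ <-] [q _ <-]; exists (p * q) => //; rewrite rmorphM. Qed.

Lemma rational_div x y : rational x -> rational y -> rational (x / y).
Proof.
by move=> [p _ <-] [q _ <-]; exists (p / q) => //; rewrite fmorph_div.
Qed.

Lemma rationalX x n : rational x -> rational (x ^+ n).
Proof. by move=> [p _ <-]; exists (p ^+ n) => //; rewrite rmorphXn. Qed.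

Lemma rational_sum (I : Type) (s : seq I) (P : pred I) (g : I -> R) :
  (forall i, P i -> rational (g i)) -> rational (\sum_(i <- s | P i) g i).
Proof.
by move=> h; elim/big_ind: _ => //; [exact: (rational_nat 0)|exact: rationalD].
Qed.

Lemma irrational_affine c x y :
  rational c -> c != 0 -> rational y -> irrational x -> irrational (c * x + y).
Proof.
move=> hc c0 hy hx h; apply: hx.
have -> : x = (c * x + y - y) / c by field.
by apply: rational_div => //; apply: rationalB.
Qed.

Lemma rational_common_denominator (a : nat -> R) m :
  (forall i, (i < m)%N -> rational (a i)) ->
  exists2 q : nat, (0 < q)%N & forall i, (i < m)%N -> q%:R * a i \is a Num.int.
Proof.
elim: m => [|m IH] ha; first by exists 1%N.
have [|q q0 hq] := IH; first by move=> i im; apply: ha; exact: ltnW.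
have /rationalP[z [b hz]] := ha m (ltnSn m).
have [b0|b0] := posnP b.
  exists q => // i; rewrite ltnS leq_eqVlt => /predU1P[->|]; last exact: hq.
  by rewrite hz b0 invr0 !mulr0 rpred0.
exists (q * b)%N; first by rewrite muln_gt0 q0.
move=> i; rewrite natrM ltnS leq_eqVlt => /predU1P[->|/hq h].
  have -> : q%:R * b%:R * a m = q%:R * z%:~R.
    by rewrite hz; field; rewrite pnatr_eq0 -lt0n.
  by apply: rpredM; rewrite ?natr_int ?intr_int.
by rewrite mulrAC rpredM ?natr_int.
Qed.
End Rationality.

(** * Weyl sums of polynomials with an irrational coefficient *)
Section Weyl.
Context {R : realType}.
Implicit Types (f : {poly R}).

(** Let q be a common denominator of the coefficients of degree at least 2.
    As q divides (n + q)^i - n^i, shifting n by q changes f(n) by q f_1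
    modulo 1, so the summand is multiplied by the constant c = e(q f_1), which
    is not 1. Hence c - 1 times the sum is the difference of the sum and its
    shift, and the sum is bounded. *)
Lemma weyl_linear f :
  irrational f`_1 -> (forall i, (1 < i)%N -> rational f`_i) ->
  sublinear (fun N => modulus (\sum_(1 <= n < N.+1) phase f.[n%:R])).
Proof.
move=> irr rat.
have [|q q0 hq] := rational_common_denominator (fun i => f`_i.+2) (size f).
  by move=> i _; exact: rat.
have qR : q%:R != 0 :> R by rewrite pnatr_eq0 -lt0n.
pose c := phase (q%:R * f`_1).
have c1 : 0 < modulus (c - 1).
  rewrite lt_def modulus_ge0 andbT; apply/eqP => h.
  have /eqP : `|c - 1| = 0 by rewrite normE h.
  rewrite normr_eq0 subr_eq0 => /eqP /phase_eq1 /intrP[z hz].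
  apply: irr; have -> : f`_1 = z%:~R / q%:R by rewrite -hz; field.
  by apply/rationalP; exists z, q.
have step n : phase f.[(n + q)%:R] = c * phase f.[n%:R].
  have -> : f.[(n + q)%:R] = q%:R * f`_1 + (f.[n%:R] +
      \sum_(2 <= i < (size f).+2) f`_i * ((n + q)%:R ^+ i - n%:R ^+ i)).
    have hf (x : R) : f.[x] =
        f`_0 + f`_1 * x + \sum_(2 <= i < (size f).+2) f`_i * x ^+ i.
      rewrite (@horner_coef_wide _ (size f).+2); last by rewrite ltnW // ltnW.
      rewrite -(big_mkord xpredT (fun i => f`_i * x ^+ i)).
      by rewrite big_ltn // big_ltn // expr0 mulr1 expr1 addrA.
    rewrite !hf; under [X in _ + (_ + X)]eq_bigr do rewrite mulrBr.
    by rewrite sumrB natrD; ring.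
  rewrite phaseD -/c phaseD [X in _ * (_ * X)]phase_int ?mulr1 //.
  rewrite big_nat; apply: rpred_sum => i /andP[i2 ilt].
  rewrite subrXX [(n + q)%N]addnC natrD addrK mulrA [f`_i * _]mulrC.
  apply: rpredM.
    by case: i i2 ilt => [|[|i]] // _; rewrite !ltnS; exact: hq.
  by apply: rpred_sum => j _; rewrite -natrD -!natrX -natrM natr_int.
apply: (sublinear_le (fun=> 2 * q%:R / modulus (c - 1))); last first.
  exact: sublinear_bounded.
move=> N; rewrite ler_pdivlMr // mulrC -modulusM mulrBl mul1r mulr_sumr.
under eq_bigr do rewrite -step.
apply: (shifted_sum_le (fun n => phase f.[n%:R])) => n.
by rewrite modulus_phase.
Qed.

(** Differencing lowers by one the degree of the last irrational coefficient:
    in f(x + h) - f(x + l) the coefficient of degree j is the sum over i of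
    (h^i - l^i) C(i + j, i) f_(i + j), where the term i = 0 vanishes. If
    f_(k + 2) is the last irrational coefficient, then for j = k + 1 the term
    i = 1 is a nonzero integer times it and the other terms are rational; for
    larger j all terms are rational. *)
Lemma weyl_leading k f :
  irrational f`_k.+1 -> (forall i, (k.+1 < i)%N -> rational f`_i) ->
  sublinear (fun N => modulus (\sum_(1 <= n < N.+1) phase f.[n%:R])).
Proof.
elim: k f => [|k IH] f irr rat; first exact: weyl_linear.
apply: van_der_corput => [n|h l hl]; first by rewrite modulus_phase.
pose g := \sum_(i < size f) (h%:R ^+ i - l%:R ^+ i) *: f^`N(i).
have gE x : g.[x] = f.[x + h%:R] - f.[x + l%:R].
  rewrite !nderiv_taylor ?/GRing.comm; try exact: mulrC.
  rewrite horner_sum -sumrB; apply: eq_bigr => i _.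
  by rewrite hornerZ mulrBl ![_ * f^`N(i).[x]]mulrC.
have gc j : g`_j = \sum_(i < size f)
    (h%:R ^+ i - l%:R ^+ i) * (f`_(i + j) *+ 'C(i + j, i)).
  by rewrite coef_sum; apply: eq_bigr => i _; rewrite coefZ coef_nderivn.
apply: (eq_sublinear
  (fun N => modulus (\sum_(1 <= n < N.+1) phase g.[n%:R]))).
  move=> N; congr modulus; apply: eq_bigr => n _.
  by rewrite conj_phase -phaseD gE -!natrD.
have ratc i : rational (h%:R ^+ i - l%:R ^+ i : R).
  by apply: rationalB; apply: rationalX; exact: rational_nat.
have ratt i j : (k.+2 < i + j)%N ->
    rational ((h%:R ^+ i - l%:R ^+ i) * (f`_(i + j) *+ 'C(i + j, i))).
  move=> ij; apply: rationalM => //; rewrite -mulr_natr.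
  by apply: rationalM; [exact: rat|exact: rational_nat].
have s1 : (1 < size f)%N.
  rewrite ltnNge; apply/negP => sf; apply: irr.
  by rewrite nth_default; [exact: (rational_nat 0)|exact: leq_trans sf _].
apply: IH.
  rewrite gc (bigD1 (Ordinal s1)) //= !expr1 add1n bin1.
  rewrite -[f`__ *+ _]mulr_natr mulrCA mulrC.
  apply: irrational_affine => //.
  - apply: rationalM; last exact: rational_nat.
    by rewrite -(expr1 h%:R) -(expr1 l%:R).
  - by rewrite mulf_neq0 ?pnatr_eq0 // subr_eq0 eqr_nat.
  apply: rational_sum => -[[|[|i]] hi] //= _.
    by rewrite !expr0 subrr mul0r; exact: (rational_nat 0).
  by apply: ratt; rewrite !addSn !addnS !ltnS leq_addl.
move=> j kj; rewrite gc; apply: rational_sum => -[[|i] hi] _ /=.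
  by rewrite !expr0 subrr mul0r; exact: (rational_nat 0).
by apply: ratt; rewrite addSn ltnS (leq_trans kj) // leq_addl.
Qed.

Theorem weyl_sum_sublinear f :
  (exists k, (0 < k)%N /\ irrational f`_k) ->
  sublinear (fun N => modulus (\sum_(1 <= n < N.+1) phase f.[n%:R])).
Proof.
move=> [k [k0 hk]].
pose P := [pred i : nat | `[< irrational f`_i >]].
have exP : exists i, P i by exists k; apply/asboolP.
have ubP i : P i -> (i <= size f)%N.
  move=> /asboolP irr; rewrite leqNgt; apply/negP => si; apply: irr.
  by rewrite nth_default; [exact: (rational_nat 0)|exact: ltnW].
case: (ex_maxnP exP ubP) => m /asboolP hm mmax.
have km : (k <= m)%N by apply: mmax; apply/asboolP.
case: m hm mmax km => [|m] hm mmax km; first by rewrite leqNgt k0 in km.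
apply: (weyl_leading m f hm) => i mi; apply: contrapT => irr.
by have := mmax i (asboolT irr); rewrite leqNgt mi.
Qed.
End Weyl.

(** * Sums over multiples *)
Lemma sum_multiples {V : nmodType} (a : nat -> V) (d N : nat) : (0 < d)%N ->
  \sum_(1 <= n < N.+1 | (d %| n)%N) a n =
  \sum_(1 <= m < (N %/ d).+1) a (d * m)%N.
Proof.
move=> d0; elim: N => [|N IH]; first by rewrite div0n !big_geq.
rewrite big_mkcond big_nat_recr //= -big_mkcond IH divnS //.
case: ifP => hd /=; last by rewrite add0n addr0.
rewrite add1n [RHS]big_nat_recr //=; congr (_ + _); congr a.
by rewrite -{1}(divnK hd) divnS // hd add1n mulnC.
Qed.

Lemma sum_dilates {V : nmodType} (a : nat -> V) (d N : nat) : (0 < d)%N ->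
  \sum_(1 <= m < N.+1) (if (d * m <= N)%N then a m else 0) =
  \sum_(1 <= m < (N %/ d).+1) a m.
Proof.
move=> d0; rewrite (big_cat_nat (n := (N %/ d).+1)) //=; last first.
  by rewrite ltnS leq_div.
rewrite [X in _ + X]big_nat [X in _ + X]big1 ?addr0 => [|m /andP[hm _]].
  rewrite !big_nat; apply: eq_bigr => m /andP[_]; rewrite ltnS leq_divRL //.
  by rewrite mulnC => ->.
by rewrite mulnC -leq_divRL // leqNgt hm.
Qed.

(** * Divergence of the sum of the reciprocals of the primes *)
Section PrimeReciprocals.
Context {R : realType}.

Definition smooth (k n : nat) := all (fun p => (p < k)%N) (primes n).
Definition smooth_sum (k N : nat) : R :=
  \sum_(1 <= n < N.+1 | smooth k n) n%:R^-1.

Lemma smooth_sum0_le1 N : smooth_sum 0 N <= 1.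
Proof.
rewrite /smooth_sum; case: N => [|N]; first by rewrite big_geq.
rewrite big_mkcond big_ltn //= invr1 big1_seq ?addr0 // => n.
rewrite mem_index_iota => /= /andP[n1 _].
case: ifP => // /allP /(_ (pdiv n)).
by rewrite mem_primes pdiv_prime // pdiv_dvd (ltnW n1) => /(_ isT).
Qed.

(** Let k be prime. A (k+1)-smooth integer is k-smooth or is k times a
    (k+1)-smooth integer, so the sums T_k satisfy T_(k+1) <= T_k + T_(k+1) / k.
    For t = 1/k <= 1/2 one has 1 / (1 - t) <= 1 + 2t <= exp (2t). This is one
    factor of Euler's product, without an infinite product. *)
Lemma smooth_sumS k N :
  smooth_sum k.+1 N <= smooth_sum k N * expR (if prime k then 2 / k%:R else 0).
Proof.
have T0 j : 0 <= smooth_sum j N by apply: sumr_ge0 => n _; rewrite invr_ge0.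
have smS n : (0 < n)%N -> ~~ (prime k && (k %| n)%N) ->
    smooth k.+1 n -> smooth k n.
  move=> n0 kn /allP sm; apply/allP => p pn; have := sm p pn.
  rewrite ltnS leq_eqVlt => /predU1P[pk|//]; move: pn kn.
  by rewrite mem_primes pk n0 => /= ->.
case: ifPn => pk; last first.
  rewrite expR0 mulr1 /smooth_sum big_mkcond [leRHS]big_mkcond !big_nat.
  apply: ler_sum => n /andP[n0 _]; case: ifP => [sm|_]; last first.
    by case: ifP; rewrite ?invr_ge0.
  by rewrite (smS n) ?(negbTE pk).
have k0 := prime_gt0 pk; have k1 := prime_gt1 pk.
have kR : 2 <= k%:R :> R by rewrite ler_nat.
have kV : 0 < k%:R^-1 :> R by rewrite invr_gt0 ltr0n.
have kV2 : k%:R^-1 <= 2^-1 :> R by rewrite lef_pV2 ?posrE ?ltr0n.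
(* The terms with k | n are 1/(k m) with m <= N/k and m again (k+1)-smooth. *)
have rec : smooth_sum k.+1 N <= smooth_sum k N + k%:R^-1 * smooth_sum k.+1 N.
  rewrite {1}/smooth_sum (bigID (fun n => (k %| n)%N)) /= addrC; apply: lerD.
    rewrite /smooth_sum big_mkcond [leRHS]big_mkcond !big_nat.
    apply: ler_sum => n /andP[n0 _]; case: ifP => [/andP[sm kn]|_]; last first.
      by case: ifP; rewrite ?invr_ge0.
    by rewrite (smS n) // pk.
  under eq_bigl do rewrite andbC.
  rewrite big_mkcondr sum_multiples // /smooth_sum mulr_sumr [leRHS]big_mkcond.
  rewrite [leRHS](big_cat_nat (n := (N %/ k).+1)) //=; last first.
    by rewrite ltnS leq_div.
  rewrite -[leLHS]addr0; apply: lerD; last first.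
    by apply: sumr_ge0 => n _; case: ifP; rewrite // mulr_ge0 ?invr_ge0.
  rewrite big_nat [leRHS]big_nat; apply: ler_sum => m /andP[m0 _].
  case: ifP => [/allP sm|_]; last by case: ifP; rewrite // mulr_ge0 ?invr_ge0.
  have -> : smooth k.+1 m.
    apply/allP => p; rewrite mem_primes => /and3P[pp _ pm]; apply: sm.
    by rewrite mem_primes pp muln_gt0 k0 m0 dvdn_mull.
  by rewrite natrM invfM.
have h : smooth_sum k.+1 N <= smooth_sum k N * (1 + 2 / k%:R).
  move: (T0 k) (T0 k.+1) rec kV kV2.
  set a := smooth_sum _ _; set b := smooth_sum _ _.
  move: (k%:R^-1) => t a0 b0 abt t0 t2.
  have h1 : (b - t * b) * (1 + 2 * t) <= a * (1 + 2 * t).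
    by apply: ler_wpM2r; lra.
  apply: le_trans h1; have h2 : 0 <= b * (t * (1 - 2 * t)).
    by rewrite !mulr_ge0 //; lra.
  lra.
apply: le_trans h _; apply: ler_wpM2l => //; exact: expR_ge1Dx.
Qed.

Lemma harmonic_le_expR N :
  \sum_(1 <= n < N.+1) n%:R^-1 <=
  expR (2 * \sum_(p <- iota 0 N.+1 | prime p) p%:R^-1) :> R.
Proof.
have -> : \sum_(1 <= n < N.+1) n%:R^-1 = smooth_sum N.+1 N.
  rewrite /smooth_sum big_nat_cond [RHS]big_nat_cond; apply: eq_bigl => n.
  rewrite andbT; case: (boolP (_ && _)) => //= /andP[n0 nN].
  symmetry; apply/allP => p; rewrite mem_primes => /and3P[_ _ /dvdn_leq pn].
  exact: leq_ltn_trans (pn n0) nN.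
elim: N.+1 => [|k IH]; first by rewrite big_nil mulr0 expR0 smooth_sum0_le1.
apply: le_trans (smooth_sumS _ _) _.
rewrite -[k.+1]addn1 iotaD big_cat big_cons big_nil add0n /= mulrDr expRD.
apply: ler_pM => //.
- by apply: sumr_ge0 => n _; rewrite invr_ge0.
- exact: expR_ge0.
- by case: ifP; rewrite ?addr0 ?mulr0.
Qed.

(** Otherwise [harmonic_le_expR] would bound the harmonic series. *)
Lemma sum_prime_reciprocals_unbounded (B : R) :
  exists X, B <= \sum_(p <- iota 0 X | prime p) p%:R^-1.
Proof.
apply: contrapT => /forallNP hB.
apply: (@dvg_harmonic R); apply: nondecreasing_is_cvgn.
  by apply: nondecreasing_series => n _ _; exact: harmonic_ge0.
exists (expR (2 * B)) => _ [N _ <-].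
have := harmonic_le_expR N; rewrite big_add1 /= => h.
apply: le_trans h _; rewrite ler_expR ler_pM2l //.
apply/ltW; rewrite ltNge; apply/negP; exact: (hB N.+1).
Qed.

(** The sharper bound 2 - 1/N is the one that passes through the induction, by
    1/(N+1)^2 <= 1/N - 1/(N+1). *)
Lemma sum_inv_sqr_le N : \sum_(1 <= n < N.+1) (n%:R ^+ 2)^-1 <= 2 :> R.
Proof.
suff : N = 0%N \/ \sum_(1 <= n < N.+1) (n%:R ^+ 2)^-1 <= 2 - N%:R^-1 :> R.
  case=> [->|h]; first by rewrite big_geq.
  by apply: le_trans h _; rewrite gerBl invr_ge0.
elim: N => [|N IH]; [by left|right].
rewrite big_nat_recr //=; case: IH => [->|IH].
  by rewrite big_geq // expr1n; lra.
have [->|N0] := posnP N; first by rewrite big_geq // expr1n; lra.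
apply: le_trans (lerD IH (lexx _)) _.
have NR : 1 <= N%:R :> R by rewrite ler1n.
rewrite -[N.+1%:R]natr1; move: (N%:R) NR => x x1.
rewrite -subr_ge0.
have -> : 2 - (x + 1)^-1 - (2 - x^-1 + ((x + 1) ^+ 2)^-1) =
          (x * (x + 1) ^+ 2)^-1.
  by field; lra.
by rewrite invr_ge0 mulr_ge0 ?sqr_ge0 //; lra.
Qed.

Lemma sum_prime_inv_sqr_le X :
  \sum_(p <- iota 0 X | prime p) (p%:R ^+ 2)^-1 <= 2 :> R.
Proof.
case: X => [|X]; first by rewrite big_nil.
rewrite /= big_cons /=; apply: le_trans (sum_inv_sqr_le X).
rewrite /index_iota subSS subn0 big_mkcond; apply: ler_sum => n _.
by case: ifP; rewrite // invr_ge0 sqr_ge0.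
Qed.
End PrimeReciprocals.

(** * Centered divisibility indicators *)
Section TuranKubilius.
Context {R : realType}.

(** Divisibility by d has mean 1/d; subtracting it makes the indicators for
    coprime moduli uncorrelated, up to the rounding in N/d. *)
Definition centered_dvd (d n : nat) : R := (d %| n)%:R - d%:R^-1.

Lemma count_multiples (d N : nat) : (0 < d)%N ->
  \sum_(1 <= n < N.+1) (d %| n)%:R = (N %/ d)%:R :> R.
Proof.
move=> d0; under eq_bigr do rewrite mulrb.
by rewrite -big_mkcond sum_multiples // big_const_nat subn1 iter_addr_0.
Qed.

Lemma count_multiples_bounds (d N : nat) : (0 < d)%N ->
  (N%:R / d%:R - 1 <= (N %/ d)%:R :> R) && ((N %/ d)%:R <= N%:R / d%:R :> R).
Proof.
move=> d0; have dR : 0 < d%:R :> R by rewrite ltr0n.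
rewrite ler_pdivlMr // -natrM ler_nat leq_divM andbT lerBlDr.
rewrite ler_pdivrMr // natr1 -natrM ler_nat.
exact/ltnW/ltn_ceil.
Qed.

Lemma centered_dvd_variance (d N : nat) : (1 < d)%N ->
  \sum_(1 <= n < N.+1) centered_dvd d n ^+ 2 <= d%:R^-1 * N%:R.
Proof.
move=> d1; have d0 := ltnW d1.
have dV : 0 < d%:R^-1 :> R by rewrite invr_gt0 ltr0n.
have dV2 : d%:R^-1 <= 2^-1 :> R by rewrite lef_pV2 ?posrE ?ltr0n // ler_nat.
have sq n : centered_dvd d n ^+ 2 =
    (1 - 2 * d%:R^-1) * (d %| n)%:R + d%:R^-1 ^+ 2.
  by rewrite /centered_dvd; case: (d %| n)%N => /=; ring.
under eq_bigr do rewrite sq.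
rewrite big_split /= -mulr_sumr count_multiples //.
rewrite big_const_nat subn1 iter_addr_0 /=.
have /andP[_] := count_multiples_bounds _ N d0.
rewrite -[_ ^+ 2 *+ N]mulr_natr.
move: (N %/ d)%:R (N%:R : R) (ler0n R N) (d%:R^-1) dV dV2.
move=> c n n0 t t0 t2 hc.
have : (1 - 2 * t) * c <= (1 - 2 * t) * (n * t) by apply: ler_wpM2l => //; lra.
have : 0 <= n * t ^+ 2 by rewrite mulr_ge0 // sqr_ge0.
lra.
Qed.

Lemma centered_dvd_correlation (d e N : nat) :
  (0 < d)%N -> (0 < e)%N -> coprime d e ->
  `|\sum_(1 <= n < N.+1) centered_dvd d n * centered_dvd e n| <= 2.
Proof.
move=> d0 e0 de.
have ex n : centered_dvd d n * centered_dvd e n =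
   ((d * e)%N %| n)%:R - e%:R^-1 * (d %| n)%:R - d%:R^-1 * (e %| n)%:R +
   d%:R^-1 * e%:R^-1.
  rewrite /centered_dvd Gauss_dvd //.
  by case: (d %| n)%N; case: (e %| n)%N => /=; ring.
under eq_bigr do rewrite ex.
rewrite big_split !sumrB /= -!mulr_sumr !count_multiples ?muln_gt0 ?d0 //.
rewrite big_const_nat subn1 iter_addr_0 /= -[_ *+ N]mulr_natr.
have /andP[] := count_multiples_bounds _ N d0.
have /andP[] := count_multiples_bounds _ N e0.
have := count_multiples_bounds (d * e) N.
rewrite muln_gt0 d0 e0 => /(_ isT) /andP[].
rewrite natrM invfM.
have : d%:R^-1 <= 1 :> R by rewrite invf_le1 ?ler1n ?ltr0n.
have : e%:R^-1 <= 1 :> R by rewrite invf_le1 ?ler1n ?ltr0n.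
have : 0 <= d%:R^-1 :> R by rewrite invr_ge0.
have : 0 <= e%:R^-1 :> R by rewrite invr_ge0.
move: (N %/ d)%:R (N %/ e)%:R (N %/ (d * e))%:R (d%:R^-1) (e%:R^-1) (N%:R : R).
move=> a b c s t n.
move=> t0 s0 t1 s1 c1 c2 b1 b2 a1 a2.
have [x0 x1] : 0 <= t * (n * s - a) /\ t * (n * s - a) <= 1.
  by split; [apply: mulr_ge0; lra|apply: mulr_ile1; lra].
have [y0 y1] : 0 <= s * (n * t - b) /\ s * (n * t - b) <= 1.
  by split; [apply: mulr_ge0; lra|apply: mulr_ile1; lra].
by rewrite ler_norml; apply/andP; split; lra.
Qed.
End TuranKubilius.

(** * Orthogonality to multiplicative functions *)
Section Katai.
Context {R : realType}.

(** Let s be a finite set of primes and M the sum of their reciprocals.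
    - Since the centered indicators of divisibility are almost orthogonal, an
      integer n has on average M divisors in s with error sqrt M: M times the
      sum of F(n) g(n) is, up to O(N sqrt M), the sum Z of
      F(p m) g(p m) over p in s and p m <= N (Turan-Kubilius).
    - By multiplicativity F(p m) = F(p) F(m) unless p divides m, which happens
      for at most N/p^2 values of m, so that Z differs by O(N) from the
      bilinear sum V of F(m) F(p) g(p m).
    - The correlation hypothesis says that the sequences g(p m) for distinct p
      are almost orthogonal, so V = O(N sqrt M).
    Divide by M, which is as large as desired. *)
Theorem katai_criterion (F g : nat -> Cplx R) (C : R) :
  1 <= C ->
  (forall n, (0 < n)%N -> modulus (F n) <= C) ->
  multiplicative_fun F ->
  (forall n, modulus (g n) <= 1) ->
  (forall p q, prime p -> prime q -> p != q ->
     sublinear (fun N =>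
       modulus (\sum_(1 <= n < N.+1) g (p * n)%N * (g (q * n)%N)^*%C))) ->
  sublinear (fun N => modulus (\sum_(1 <= n < N.+1) F n * g n)).
Proof.
move=> C1 hF mF hg hcor e e0.
have C0 : 0 < C by lra.
have CC1 : 1 <= C ^+ 2 by rewrite exprn_ege1.
have CC0 : 0 < C ^+ 2 by rewrite exprn_gt0.
have [|B hB] := sqrt_growth (e / C ^+ 2); first by rewrite divr_gt0.
have [X hX] := sum_prime_reciprocals_unbounded (Num.max 1 B).
pose s := [seq p <- iota 0 X | prime p].
have us : uniq s by rewrite filter_uniq // iota_uniq.
have sp p : p \in s -> prime p by rewrite mem_filter => /andP[].
pose M : R := \sum_(p <- s) p%:R^-1.
have [M1 MB] : 1 <= M /\ B <= M.
  by apply/andP; rewrite -ge_max /M big_filter.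
have TK : \forall N \near \oo,
    modulus (\sum_(1 <= n < N.+1)
      (F n * g n) * \sum_(p <- s) (centered_dvd p n)%:C)
    <= C * N%:R * Num.sqrt (M + 1).
  apply: (almost_orthogonal s (fun p _ n => (centered_dvd p n)%:C)) => //.
  - move=> n n0; rewrite modulusM -[leRHS]mulr1.
    by apply: ler_pM; rewrite ?modulus_ge0 ?hF.
  - move=> p N /sp pp.
    apply: le_trans (centered_dvd_variance _ N (prime_gt1 pp)).
    by apply: ler_sum => n _; rewrite modulus_real real_normK ?num_real.
  - move=> p q /sp pp /sp pq npq.
    apply: (sublinear_le (fun=> 2)); last exact: sublinear_bounded.
    move=> N; under eq_bigr do rewrite conjc_real -rmorphM /=.
    rewrite -rmorph_sum modulus_real centered_dvd_correlation ?prime_gt0 //.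
    by rewrite prime_coprime // dvdn_prime2.
(* The product p m exceeds N for some m <= N: the truncation depends on N. *)
pose W p N m := if (p * m <= N)%N then F p * g (p * m)%N else 0.
have KA : \forall N \near \oo,
    modulus (\sum_(1 <= n < N.+1) F n * \sum_(p <- s) W p N n)
    <= C * N%:R * Num.sqrt (\sum_(p <- s) C ^+ 2 / p%:R + 1).
  apply: (almost_orthogonal s W) => //.
  - move=> p N /sp pp; have p0 := prime_gt0 pp.
    have -> : \sum_(1 <= n < N.+1) modulus (W p N n) ^+ 2 =
        \sum_(1 <= m < (N %/ p).+1) modulus (F p * g (p * m)%N) ^+ 2.
      rewrite -sum_dilates //; apply: eq_bigr => n _; rewrite /W.
      by case: ifP => // _; rewrite modulus0 expr0n.
    apply: (@le_trans _ _ (C ^+ 2 * (N %/ p)%:R)).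
      have -> : C ^+ 2 * (N %/ p)%:R = \sum_(1 <= m < (N %/ p).+1) C ^+ 2.
        by rewrite big_const_nat subn1 iter_addr_0 /= mulr_natr.
      rewrite big_nat [leRHS]big_nat; apply: ler_sum => m /andP[m0 _].
      apply: lerXn2r; rewrite ?nnegrE ?modulus_ge0 ?(ltW C0) //.
      rewrite modulusM -[leRHS]mulr1.
      by apply: ler_pM; rewrite ?modulus_ge0 ?hF.
    rewrite [leRHS]mulrAC -[leRHS]mulrA; apply: ler_wpM2l; first exact: ltW.
    by have /andP[] := @count_multiples_bounds R p N p0.
  - move=> p q /sp pp /sp pq npq.
    have p0 := prime_gt0 pp.
    have r0 : (0 < maxn p q)%N by rewrite leq_max p0.
    pose G N := modulus (\sum_(1 <= n < N.+1) g (p * n)%N * (g (q * n)%N)^*%C).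
    apply: (eq_sublinear
      (fun N => modulus (F p * (F q)^*%C) * G (N %/ maxn p q)%N)).
      move=> N; rewrite /G -modulusM mulr_sumr -sum_dilates //.
      congr modulus.
      apply: eq_bigr => n _; rewrite /W maxnMl geq_max.
      case: ifP => _; last by rewrite mul0r.
      case: ifP => _; last by rewrite conjc0 mulr0.
      by rewrite rmorphM /= mulrACA.
    apply: sublinearZ; first exact: modulus_ge0.
    by apply: sublinear_div => //; exact: hcor.
near=> N.
have NR : 0 <= N%:R :> R by [].
have : modulus (\sum_(1 <= n < N.+1) F n * \sum_(p <- s) W p N n)
    <= C * N%:R * Num.sqrt (\sum_(p <- s) C ^+ 2 / p%:R + 1) by near: N.
have : modulus (\sum_(1 <= n < N.+1)
      (F n * g n) * \sum_(p <- s) (centered_dvd p n)%:C)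
    <= C * N%:R * Num.sqrt (M + 1) by near: N.
set U := \sum_(1 <= n < N.+1) _; set V := \sum_(1 <= n < N.+1) _ => hU hV.
set S := \sum_(1 <= n < N.+1) _.
pose Z := \sum_(p <- s) \sum_(1 <= m < (N %/ p).+1) F (p * m)%N * g (p * m)%N.
(* Z counts F(n) g(n) once for each divisor of n in s, U subtracts M from
   this multiplicity. *)
have SE : M%:C * S = Z - U.
  rewrite /U; under eq_bigr do rewrite mulr_sumr.
  rewrite exchange_big /= /Z /M rmorph_sum mulr_suml -sumrB.
  rewrite big_seq [RHS]big_seq; apply: eq_bigr => p /sp pp.
  rewrite -(sum_multiples (fun n => F n * g n)) ?prime_gt0 //.
  rewrite [X in X - _]big_mkcond /= mulr_sumr -sumrB.
  apply: eq_bigr => n _; rewrite /centered_dvd rmorphB /=.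
  case: (p %| n)%N; rewrite ?rmorph1 ?rmorph0; ring.
have hZ : modulus (Z - V) <= 4 * C ^+ 2 * N%:R.
  rewrite /V; under eq_bigr do rewrite mulr_sumr.
  rewrite exchange_big /= /Z -sumrB.
  have -> : 4 * C ^+ 2 * N%:R = 2 * C ^+ 2 * N%:R * 2 by ring.
  apply: (@le_trans _ _
    (2 * C ^+ 2 * N%:R * \sum_(p <- s) (p%:R ^+ 2)^-1)); last first.
    apply: ler_wpM2l; first by rewrite !mulr_ge0 // ltW.
    by rewrite big_filter; exact: sum_prime_inv_sqr_le.
  apply: le_trans (modulus_sum _ _ _) _; rewrite mulr_sumr.
  rewrite big_seq [leRHS]big_seq; apply: ler_sum => p /sp pp.
  have p0 := prime_gt0 pp.
  have -> : \sum_(1 <= m < N.+1) F m * W p N m =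
      \sum_(1 <= m < (N %/ p).+1) F m * (F p * g (p * m)%N).
    rewrite -sum_dilates //; apply: eq_bigr => m _; rewrite /W.
    by case: ifP => // _; rewrite mulr0.
  rewrite -sumrB; apply: le_trans (modulus_sum _ _ _) _.
  apply: (@le_trans _ _ (\sum_(1 <= m < (N %/ p).+1) 2 * C ^+ 2 * (p %| m)%:R)).
    rewrite big_nat [leRHS]big_nat; apply: ler_sum => m /andP[m0 _].
    rewrite mulrA -mulrBl modulusM -[leRHS]mulr1.
    apply: ler_pM; rewrite ?modulus_ge0 //.
    have [pm|pm] := boolP (p %| m)%N; last first.
      by rewrite mF // ?prime_coprime // mulrC subrr modulus0 mulr0.
    rewrite mulr1; apply: le_trans (modulusD _ _) _; rewrite modulusN modulusM.
    have h1 : modulus (F (p * m)%N) <= C by rewrite hF // muln_gt0 p0.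
    have h2 : modulus (F m) * modulus (F p) <= C ^+ 2.
      by rewrite expr2; apply: ler_pM; rewrite ?modulus_ge0 ?hF.
    have : C <= C ^+ 2 by rewrite expr2 ler_peMl // ltW.
    lra.
  rewrite -mulr_sumr count_multiples // -[leRHS]mulrA.
  apply: ler_wpM2l; first by rewrite mulr_ge0 // ltW.
  rewrite -divnMA.
  have /andP[_] := @count_multiples_bounds R (p * p) N (leq_mul p0 p0).
  by rewrite natrM expr2.
set t := Num.sqrt (M + 1) in hU.
have hV' : modulus V <= C ^+ 2 * N%:R * t.
  apply: le_trans hV _; rewrite expr2 -!mulrA.
  apply: ler_wpM2l; first exact: ltW.
  rewrite mulrCA; apply: ler_wpM2l => //.
  rewrite -[X in X * t]gtr0_norm // -sqrtr_sqr -sqrtrM ?sqr_ge0 //.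
  rewrite ler_sqrt; last first.
    by rewrite mulr_ge0 ?sqr_ge0 //; lra.
  by rewrite -mulr_sumr -/M mulrDr mulr1 lerD2l.
have hU' : modulus U <= C ^+ 2 * N%:R * t.
  apply: le_trans hU _; rewrite -[leLHS]mulrA -[leRHS]mulrA; apply: ler_wpM2r.
    by rewrite mulr_ge0 // sqrtr_ge0.
  by rewrite expr2 ler_peMl // ltW.
have hB' := hB M MB.
have M0 : 0 < M by lra.
rewrite -(ler_pM2l M0).
have -> : M * modulus S = modulus (M%:C * S).
  by rewrite modulusM modulus_real gtr0_norm.
have -> : M%:C * S = (Z - V) + (V - U) by rewrite SE addrA subrK.
apply: le_trans (modulusD _ _) _.
have hVU := modulusD V (- U); rewrite modulusN in hVU.
have : C ^+ 2 * N%:R * (2 * t + 4) <= C ^+ 2 * N%:R * (e / C ^+ 2 * M).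
  by apply: ler_wpM2l; rewrite ?mulr_ge0 // ltW.
have -> : C ^+ 2 * N%:R * (e / C ^+ 2 * M) = M * (e * N%:R) by field; lra.
lra.
Unshelve. all: by end_near. Qed.
End Katai.

Lemma Cplx_bounded (R : realType) (F : nat -> Cplx R) : bounded_posnat F ->
  exists2 C : R, 1 <= C & forall n, (0 < n)%N -> modulus (F n) <= C.
Proof.
move=> [M [Mr hM]].
have M1 : M < (Num.max 1 (complex.Re M + 1))%:C.
  rewrite -(RRe_real Mr) ltcR lt_max; apply/orP; right.
  by rewrite /= ltrDl.
exists (Num.max 1 (complex.Re M + 1)); first by rewrite le_max lexx.
move=> n n0; have := hM _ M1 n n0.
by rewrite /= normE lecR.
Qed.

(** The polynomial f(p x) - f(q x) has coefficients (p^i - q^i) f_i, and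
    p^k - q^k is a nonzero integer, so it keeps an irrational coefficient. *)
Lemma phase_poly_dilation (R : realType) (f : {poly R}) (p q : nat) :
  (exists k, (0 < k)%N /\ irrational f`_k) -> p != q ->
  sublinear (fun N =>
    modulus (\sum_(1 <= n < N.+1)
      phase f.[(p * n)%:R] * (phase f.[(q * n)%:R])^*%C)).
Proof.
move=> [k [k0 irr]] pq.
pose h : {poly R} := \poly_(i < size f) ((p%:R ^+ i - q%:R ^+ i) * f`_i).
apply: (eq_sublinear
  (fun N => modulus (\sum_(1 <= n < N.+1) phase h.[n%:R]))).
  move=> N; congr modulus.
  apply: eq_bigr => n _; rewrite conj_phase -phaseD; congr phase.
  rewrite horner_poly !horner_coef -sumrB; apply: eq_bigr => i _.
  by rewrite !natrM !exprMn; ring.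
apply: weyl_sum_sublinear; exists k; split => //.
rewrite coef_poly; case: ltnP => [_|sk]; last first.
  by case: irr; rewrite nth_default //; exact: (rational_nat 0).
rewrite -[X in irrational X]addr0; apply: irrational_affine => //.
- by apply: rationalB; apply: rationalX; exact: rational_nat.
- by rewrite subr_eq0 -!natrX eqr_nat eqn_exp2r.
- exact: (rational_nat 0).
Qed.

Theorem theorem6p3 (R : realType) (f : {poly R}) (F : nat -> Cplx R)
    (hf : exists k : nat, (0 < k)%N /\ irrational f`_k)
    (hFbounded : bounded_posnat F)
    (hFmult : multiplicative_fun F) :
  (fun N : nat =>
     N%:R^-1 * \sum_(1 <= n < N.+1) F n * expi (2 * pi * f.[n%:R]))
    @ \oo --> (0 : Cplx R).
Proof.
have [C C1 hC] := Cplx_bounded _ _ hFbounded.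
have key : sublinear (fun N =>
    modulus (\sum_(1 <= n < N.+1) F n * phase f.[n%:R])).
  apply: (katai_criterion _ _ C) => //.
  - by move=> n; rewrite modulus_phase.
  - by move=> p q _ _; exact: phase_poly_dilation.
apply/cvgr0Pnorm_le => e e0.
have er : 0 < complex.Re e by rewrite -ltcR RRe_real // gtr0_real.
near=> N.
have N0 : 0 < N%:R :> Cplx R by rewrite ltr0n; near: N; exact: nbhs_infty_gt.
have hN : modulus (\sum_(1 <= n < N.+1) F n * phase f.[n%:R]) <=
    complex.Re e * N%:R.
  by near: N; exact: key.
rewrite normrM normfV (gtr0_norm N0) ler_pdivrMl // normE.
rewrite -(RRe_real (gtr0_real e0)) -(rmorph_nat (real_complex R)) -rmorphM lecR.
by rewrite [leRHS]mulrC; exact: hN.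
Unshelve. all: by end_near. Qed.
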